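(* Let $S(t)$ be a strongly continuous semigroup with $S(0)=I$ on a complex Hilbert space, with generator $A$. Let $m:[0,+\infty[\to]0,+\infty[$ be continuous with $\log m$ piecewise differentiable, with $m(0)=1$, $\|S(t)\|\le m(t)$ for all $t\ge0$, and $\mathfrak S$-invariant, i.e. $\mathfrak S(m)=m$. Let $\Omega\subset\mathbb R$ be finite and nonempty, with $r(\omega)>0$ for all $\omega\in\Omega$. Then the iteration $m\mapsto(\mathfrak S\underline U_\Omega)^k m$ is stationary for $k\ge\#\Omega$, i.e. $$(\mathfrak S\underline U_\Omega)^k m=(\mathfrak S\underline U_\Omega)^{\#\Omega}m\qquad\text{for all }k\ge\#\Omega .$$
   Context: For $\omega\in\mathbb R$, $r(\omega)=\left(\sup_{\operatorname{Re}z>\omega}\|(z-A)^{-1}\|\right)^{-1}$, with the conventions $\|(z-A)^{-1}\|=+\infty$ if $z\in\operatorname{Spec}A$ and $1/(+\infty)=0$. Definition of $\mathfrak S$: for a function $m$ on $[0,+\infty[$ with nonnegative values and $m(0)=1$, put $$\mathfrak S(m)(t)=\lim_{N\to\infty}\ \inf_{t_1,\dots,t_N\ge0,\ t_1+\dots+t_N=t} m(t_1)m(t_2)\cdots m(t_N),\qquad t\ge0$$ (the sequence is decreasing in $N$ since $m(0)=1$). Definition of $a^*$: for $\omega\in\mathbb R$, $r>0$ and a positive function $m$, let $\phi$ be the maximal solution of $$\phi'(t)=r\left(\phi(t)^2+2\mu(t)\phi(t)+1\right),\quad \phi(0)=0,\qquad \mu(t)=\frac1r\left(\frac{m'(t)}{m(t)}-\omega\right),$$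 and $a^*(m,\omega,r)=\inf\{t\ge0: \phi(t)=1\}$ ($+\infty$ if $\phi$ never equals $1$). Definition of $U_\omega$ and $\underline U_\Omega$: with $r=r(\omega)$ and $a^*=a^*(m,\omega,r(\omega))$, $$U_\omega(m)(t)=\begin{cases} m(t),&0\le t\le 2a^*,\\ \min\{m(t),\,e^{(\omega-r(\omega))(t-2a^* )}m(a^* )^2\},&t>2a^*,\end{cases}$$ with $U_\omega(m)=m$ if $a^*=+\infty$, and $\underline U_\Omega(m)=\inf_{\omega\in\Omega}U_\omega(m)$ (pointwise). $(\mathfrak S\underline U_\Omega)^k$ denotes the $k$-fold iterate of $m\mapsto\mathfrak S(\underline U_\Omega(m))$. *)

(* Defs.v *)
From HB Require Import structures.
From mathcomp Require Import all_boot all_order all_algebra finmap complex.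
From mathcomp Require Import all_classical all_reals all_analysis.

Set Implicit Arguments.
Unset Strict Implicit.
Unset Printing Implicit Defensive.

Import Order.TTheory GRing.Theory Num.Theory.
Import numFieldNormedType.Exports.

Local Open Scope classical_set_scope.
Local Open Scope ring_scope.

(* A complex Hilbert space is a complete normed space over R[i] together with
   an inner product [dot] (conjugate-linear in its second argument) inducing
   the norm. *)
Definition induces_norm (R : realType) (H : completeNormedModType R[i])
    (dot : {dot H for Num.conj}) : Prop :=
  forall x : H, `|x| ^+ 2 = dot x x.

(* The values [S t] with [t < 0] are irrelevant junk. *)
Definition strongly_continuous_semigroup (R : realType)
    (H : completeNormedModType R[i]) (S : R -> {linear H -> H}) : Prop :=
  [/\ forall t, 0 <= t -> continuous (S t),
      forall x, S 0 x = x,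
      forall s t x, 0 <= s -> 0 <= t -> S (s + t) x = S s (S t x) &
      forall x, {within `[0, +oo[, continuous (fun t => S t x)}].

(* Graph of the generator: [generator S x y] means x \in D(A) and A x = y. *)
Definition generator (R : realType) (H : completeNormedModType R[i])
    (S : R -> {linear H -> H}) (x y : H) : Prop :=
  (h^-1)%:C%C *: (S h x - x) @[h --> 0^'+] --> y.

(* Norms on H are R[i]-valued; [complex.Re] takes them back to R. *)
Definition opnorm (R : realType) (H : completeNormedModType R[i])
    (T : H -> H) : \bar R :=
  ereal_sup [set (complex.Re `|T x|)%:E | x in [set x : H | `|x| <= 1]].

(* T is the bounded inverse of z - A : D(A) -> H, A being given by its graph:
   T y = x iff x \in D(A) and z x - A x = y. *)
Definition is_resolvent (R : realType) (H : completeNormedModType R[i])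
    (A : H -> H -> Prop) (z : R[i]) (T : {linear H -> H}) : Prop :=
  continuous T /\ forall x y, T y = x <-> A x (z *: x - y).

(* There is at most one resolvent T at z. If there is none, that is, if
   z \in Spec A, the infimum is taken over the empty set and equals +oo. *)
Definition resolvent_norm (R : realType) (H : completeNormedModType R[i])
    (A : H -> H -> Prop) (z : R[i]) : \bar R :=
  ereal_inf [set opnorm T | T in is_resolvent A z].

(* r(w). In \bar R one has +oo^-1 = 0. If H = 0 the supremum is 0 and [fine]
   sends its inverse +oo to 0; if H != 0 the supremum is nonzero. *)
Definition resolvent_r (R : realType) (H : completeNormedModType R[i])
    (A : H -> H -> Prop) (w : R) : R :=
  fine (inve (ereal_sup
    [set resolvent_norm A z | z in [set z : R[i] | w < complex.Re z]])).

Section functions_on_half_line.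
Variable R : realType.
Local Notation leb := (@lebesgue_measure R).

(* Functions on [0, +oo[ are functions R -> R whose values at negative
   arguments are irrelevant. *)
Implicit Types (f m phi : R -> R) (w r : R) (T : \bar R).

Definition frakS m (t : R) : R :=
  limn (fun N : nat =>
    inf [set \prod_(i < N) m (tau i) |
         tau in [set tau : 'I_N -> R |
                 (forall i, 0 <= tau i) /\ \sum_(i < N) tau i = t]]).

(* [0, +oo[ is cut into countably many compact intervals, finitely many of
   which meet any bounded set, and the restriction of f to each of them is
   differentiable, with one-sided derivatives at its endpoints. *)
Definition piecewise_differentiable f : Prop :=
  exists d : nat -> R,
    [/\ d 0%N = 0, forall n, d n < d n.+1, d n @[n --> \oo] --> +oo &
      forall n,
        [/\ forall t, d n < t < d n.+1 -> derivable f t 1,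
            cvg (h^-1 * (f (d n + h) - f (d n)) @[h --> 0^'+]) &
            cvg (h^-1 * (f (d n.+1 + h) - f (d n.+1)) @[h --> 0^'-])]].

Definition mu m w r (t : R) : R := r^-1 * (derive1 m t / m t - w).

(* phi solves the Cauchy problem on [0, T[. The iterates of m need not be
   piecewise differentiable (infima create new corners), only locally
   absolutely continuous, so solutions are taken in Caratheodory's sense: phi
   is locally absolutely continuous, i.e. the integral of its a.e. derivative
   (this includes phi 0 = 0), and the equation holds almost everywhere. *)
Definition solution m w r T phi : Prop :=
  [/\ phi 0 = 0,
      forall t, 0 <= t -> (t%:E < T)%E ->
        leb.-integrable `[0, t] (EFin \o derive1 phi) /\
        phi t = \int[leb]_(s in `[0, t]) derive1 phi s &
      {ae leb, forall t, 0 < t -> (t%:E < T)%E ->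
        [/\ derivable m t 1, derivable phi t 1 &
            derive1 phi t = r * (phi t ^+ 2 + 2 * mu m w r t * phi t + 1)]}].

Definition maximal_solution m w r T phi : Prop :=
  [/\ (0 < T)%E, solution m w r T phi &
      forall T' phi', (T < T')%E -> solution m w r T' phi' ->
        ~ (forall t, 0 <= t -> (t%:E < T)%E -> phi' t = phi t)].

(* The infimum is +oo when the set is empty. *)
Definition a_star m w r : \bar R :=
  ereal_inf [set t%:E | t in [set t : R | 0 <= t /\
    exists T phi, [/\ maximal_solution m w r T phi, (t%:E < T)%E & phi t = 1]]].

Definition U m w r (t : R) : R :=
  if a_star m w r is a%:E then
    if t <= 2 * a then m t
    else Num.min (m t) (expR ((w - r) * (t - 2 * a)) * m a ^+ 2)
  else m t.

Definition U_inf (Omega : {fset R}) (r : R -> R) m (t : R) : R :=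
  inf [set U m w (r w) t | w in [set` Omega]].

Definition SU (Omega : {fset R}) (r : R -> R) m : R -> R :=
  frakS (U_inf Omega r m).

End functions_on_half_line.

(* Main.v *)
Require Import Defs.
From HB Require Import structures.
From mathcomp Require Import all_boot all_order all_algebra finmap complex.
From mathcomp Require Import all_classical all_reals all_analysis.
From mathcomp Require Import measurable_realfun lra ring.

Set Implicit Arguments.
Unset Strict Implicit.
Unset Printing Implicit Defensive.

Import Order.TTheory GRing.Theory Num.Theory.
Import numFieldNormedType.Exports.

Local Open Scope classical_set_scope.
Local Open Scope ring_scope.

(** Under the iteration a point w of Omega gets used up at the first step at
    which a*(., w) is the smallest among the points not yet used up, and one
    such point is gained at every step.

    Let n be the current function and let a = a*(n, w) be minimal among the
    remaining points. For w used up, U_w(n) = n; every other U_w leaves n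
    unchanged up to twice its own a*. So the infimum of the U_w(n) equals n on
    [0, 2a]; as n is submultiplicative and frakS produces the largest
    submultiplicative minorant, the next function n' also equals n on [0, 2a].
    The number a* only depends on the function up to that time (a_star_local),
    and a < 2a, so a*(n', w) = a and
    n'(a) = n(a) (if a is infinite, nothing changes any more): the bound that
    U_w imposes on n' is the one that it imposed on n, and n' already satisfies
    it. Hence U_w(n') = n', and this persists as long as later steps change
    nothing before the time 2a. The remaining points keep a* at least a, which
    preserves the order in which points are used up (settled_step). After
    #Omega steps all the U_w act trivially and the function is a fixed point
    (settled_fixed).

    The strict inequality a < 2a requires a > 0, and it suffices to have this
    for the initial m, since no step changes anything before twice the smallest
    a*. This is the analytic part. As log m is only supposed to be
    differentiable piece by piece, m'/m need not be integrable, so Gronwall's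
    lemma does not apply to the Riccati equation. While a solution phi climbs
    from 1/2 to 1, however, the logarithmic form of the equation,
    (ln phi)' - 2 (ln m)' = r (phi + 1/phi) - 2 w <= 3 r + 2 |w|,
    holds almost everywhere, phi is absolutely continuous, and ln m is
    differentiable at every small positive time. This is enough to integrate
    the inequality (nonincreasing_off_negligible), and ln 2 is then bounded by
    a quantity that vanishes as the time at which phi reaches 1 tends to 0. *)

(** * Monotonicity from almost everywhere bounds *)

(** The supremum of the points x where the inequality between a and x holds is
    again such a point, because G is continuous and th is monotone; past it the
    local hypothesis would extend the inequality further. The function th may
    jump. *)
Lemma le_increment_local (R : realType) (a b : R) (G th : R -> R) : a <= b ->
  {within `[a, b], continuous G} ->
  {in `[a, b] &, {homo th : x y / x <= y}} ->
  (forall x, a <= x < b -> \forall y \near x^'+, G y - G x <= th y - th x) ->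
  G b - G a <= th b - th a.
Proof.
move=> ab cG thm loc.
pose A := [set x | a <= x <= b /\ G x - G a <= th x - th a].
have Aa : A a by split; [rewrite lexx ab|rewrite !subrr].
have supA : has_sup A.
  by split; [exists a|exists b => x [/andP[]]].
have ubA x : A x -> x <= sup A by apply: ub_le_sup; exact: supA.2.
have [ac cb] : a <= sup A /\ sup A <= b.
  split; first exact: ubA.
  by apply: ge_sup; [exists a|move=> x [/andP[]]].
set c := sup A in ac cb.
have Ac : A c.
  split; first by rewrite ac.
  rewrite leNgt; apply/negP => thG.
  have e0 : 0 < (G c - G a) - (th c - th a) by rewrite subr_gt0.
  have abc : `[a, b]%classic c by rewrite /= in_itv /= ac.
  have /subspace_continuousP /(_ c abc) /cvgrPdist_lt /(_ _ e0) := cG.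
  rewrite near_withinE => -[d /= d0 dP].
  have [x Ax cdx] := sup_adherent d0 supA.
  have xc : x <= c by exact: ubA.
  have [/andP[ax xb] GA] := Ax.
  have := dP x; rewrite /ball_ /= ger0_norm ?subr_ge0 // in_itv /= ax xb.
  move=> /(_ _ isT); rewrite -/c in cdx.
  have cxd : c - x < d by lra.
  move=> /(_ cxd) /(le_lt_trans (ler_norm _)).
  have : th x <= th c by apply: thm; rewrite // in_itv /= ?ax.
  by rewrite /from_subspace => ? ?; lra.
suff cb' : c = b by case: Ac => _; rewrite cb'.
apply/eqP; rewrite eq_le cb /= leNgt; apply/negP => cltb.
have /loc H : a <= c < b by rewrite ac.
near c^'+ => y.
have cy : c < y by [].
suff : A y by move/ubA; rewrite -/c leNgt cy.
split.
  by apply/andP; split; [lra|near: y; apply: nbhs_right_le].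
have : G y - G c <= th y - th c by near: y.
case: Ac => _; lra.
Unshelve. all: by end_near. Qed.

(** Outer regularity combined with the absolute continuity of the integral. *)
Lemma negligible_open_cover (R : realType) (E : set R) (q : R -> R) (e : R) :
  (@lebesgue_measure R).-negligible E ->
  (@lebesgue_measure R).-integrable setT (EFin \o q) -> 0 < e ->
  exists V, [/\ open V, E `<=` V &
    (\int[@lebesgue_measure R]_(x in V) `|q x|%:E <= e%:E)%E].
Proof.
move=> [N [mN N0 EN]] iq e0.
have [d [d0 dP]] := integral_normr_continuous iq e0.
have [|V [oV NV VN]] := @lebesgue_regularity_outer R N d mN _ d0.
  apply: le_lt_trans (ltry 0); rewrite le_eqVlt; apply/orP; left.
  by apply/eqP; exact: N0.
have mV : measurable V by exact: open_measurable.
exists V; split => //; first exact: subset_trans NV.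
have : (lebesgue_measure V < d%:E)%E.
  by rewrite -(setDUK NV) setUC measureU0 //; exact: measurableD.
move=> /(dP V mV) /ltW; rewrite -lee_fin.
rewrite /Rintegral fineK //.
apply: integrable_fin_num => //.
apply: (@integrableS _ _ _ _ setT) => //.
exact: integrable_norm.
Qed.

(** Integrates an almost everywhere inequality G' <= 0 for a G which is a sum of
    an absolutely continuous function (the term with p) and of a function
    differentiable everywhere (the constant C, which depends on x): such a G
    need not be absolutely continuous. The set E is covered by open sets V_n
    of q-measure at most e / 2^n.+1, where q = 1 + p, and the sum over n of the
    q-measures of the V_n on ]a, x] grows at every point of E faster than any
    multiple of the integral of q, while its total growth is at most e. A term
    e * x is added to absorb the error off E. *)
Lemma nonincreasing_off_negligible (R : realType) (a b : R) (G p : R -> R)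
    (E : set R) : a <= b ->
  {within `[a, b], continuous G} ->
  (@lebesgue_measure R).-negligible E ->
  (@lebesgue_measure R).-integrable `[a, b] (EFin \o p) ->
  (forall x, a <= x <= b -> 0 <= p x) ->
  (forall x, a <= x < b -> ~ E x -> forall e, 0 < e ->
     \forall y \near x^'+, G y - G x <= e * (y - x)) ->
  (forall x, a <= x < b -> E x -> exists C, \forall y \near x^'+,
     G y - G x <= C * (y - x + \int[@lebesgue_measure R]_(s in `]x, y]) p s)) ->
  G b <= G a.
Proof.
move=> ab cG E0 ip p0 GnE GE.
set mu := @lebesgue_measure R in E0 ip GE *.
pose q := (fun x => 1 + p x) \_ `[a, b].
have q0 x : 0 <= q x.
  rewrite /q patchE; case: ifPn => //; rewrite inE /= in_itv /= => /p0 px.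
  by rewrite addr_ge0.
have iq1 : mu.-integrable `[a, b] (EFin \o (fun x => 1 + p x)).
  have -> : EFin \o (fun x => 1 + p x) = (cst 1%E) \+ (EFin \o p).
    by apply/funext => x; rewrite /= EFinD.
  apply: integrableD => //; apply: continuous_compact_integrable.
    exact: segment_compact.
  by apply: continuous_subspaceT => ?; exact: cvg_cst.
have iq : mu.-integrable setT (EFin \o q).
  rewrite /q -restrict_EFin; apply/integrable_restrict => //.
  by rewrite setTI.
have qJ x y : a <= x -> x <= y -> y <= b -> (\int[mu]_(s in `]x, y]) (q s)%:E =
    (y - x + \int[mu]_(s in `]x, y]) p s)%:E)%E.
  move=> ax xy yb.
  have xyab : `]x, y] `<=` `[a, b] by apply: subset_itv; rewrite bnd_simp.
  have ip' : mu.-integrable `]x, y] (EFin \o p) by exact: integrableS ip.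
  transitivity (\int[mu]_(s in `]x, y]) (1%:E + (p s)%:E))%E.
    apply: eq_integral => s; rewrite inE => /xyab abs.
    by rewrite /q patchE ifT ?inE // EFinD.
  rewrite integralD //; last first.
    apply: integrableS (_ : mu.-integrable `[a, b] _) => //.
    apply: continuous_compact_integrable; first exact: segment_compact.
    by apply: continuous_subspaceT => ?; exact: cvg_cst.
  rewrite integral_cst // mul1e.
  rewrite EFinD /Rintegral fineK; last exact: integrable_fin_num.
  congr (_ + _)%E; transitivity (if x < y then (y - x)%:E else 0%E).
    exact: lebesgue_measure_itv.
  by case: ltP => [_|yx] //; rewrite (@le_anti _ _ x y) ?xy ?yx // subrr.
suff main e : 0 < e -> G b - G a <= e * (b - a) + e.
  rewrite leNgt -subr_gt0; apply/negP => Gab.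
  have ba1 : 0 < 2 * (b - a + 1) by rewrite mulr_gt0 // ltr_wpDl ?subr_ge0.
  move: (main ((G b - G a) / (2 * (b - a + 1)))).
  have : 0 < (G b - G a) / (2 * (b - a + 1)) by rewrite divr_gt0.
  set e := _ / _ => e0 /(_ e0).
  have : e * (2 * (b - a + 1)) = G b - G a by rewrite mulfVK // gt_eqF.
  by move=> ? ?; nra.
move=> e0.
have /choice[V HV] : forall n, exists V, [/\ open V, E `<=` V &
    (\int[mu]_(x in V) `|q x|%:E <= (e / (2 ^ n.+1)%:R)%:E)%E].
  move=> n; apply: negligible_open_cover => //.
  by rewrite divr_gt0 // ltr0n expn_gt0.
have mV n : measurable (V n) by apply: open_measurable; case: (HV n).
have mq A : measurable_fun A (EFin \o q).
  by apply: measurable_funTS; exact: measurable_int iq.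
pose I n x := (\int[mu]_(s in V n `&` `]a, x]) (q s)%:E)%E.
have I0 n x : (0 <= I n x)%E by apply: integral_ge0 => s _; rewrite lee_fin.
have mI n x : measurable (V n `&` `]a, x]) by exact: measurableI.
have Ile n x : (I n x <= (e / (2 ^ n.+1)%:R)%:E)%E.
  have [_ _ h] := HV n; refine (le_trans _ h).
  under eq_integral do rewrite ger0_norm //.
  apply: ge0_subset_integral; [exact: mI|exact: mV|exact: mq| |exact: subIsetl].
  by move=> s _; rewrite lee_fin.
have [S SE] : exists S, forall x, S x = (\sum_(n <oo) I n x)%E by eexists.
have sumI x : (S x <= e%:E)%E.
  apply: le_trans (epsilon_trick0 xpredT (ltW e0)).
  by rewrite SE; apply: lee_nneseries => n *; [exact: I0|exact: Ile].
have sumI0 x : (0 <= S x)%E.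
  by rewrite SE; apply: nneseries_ge0 => n *; exact: I0.
have sumIf x : S x \is a fin_num.
  by rewrite ge0_fin_numE // (le_lt_trans (sumI x)) // ltry.
have Ihomo n x y : x <= y -> (I n x <= I n y)%E.
  move=> xy; apply: ge0_subset_integral; [exact: mI|exact: mI|exact: mq| |].
    by move=> s _; rewrite lee_fin.
  by apply: setIS; apply: subset_itvl; rewrite bnd_simp.
pose th x := e * x + fine (S x).
have thm x y : x <= y -> fine (S x) <= fine (S y).
  move=> xy; apply: fine_le => //; rewrite !SE.
  apply: lee_nneseries => n *; first exact: I0.
  exact: Ihomo.
have : G b - G a <= th b - th a.
  apply: le_increment_local => //.
    by move=> x y _ _ xy; rewrite /th lerD // ?thm // ler_pM2l.
  move=> x /[dup] axb /andP[ax xb]; have [Ex|nEx] := pselect (E x); last first.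
    near=> y.
    have xy : x < y by [].
    have : G y - G x <= e * (y - x) by near: y; exact: GnE.
    have := thm _ _ (ltW xy); rewrite /th; lra.
  (* Near x, ]x, y] lies in N of the sets V_n, and each contributes the full
     q-measure J of ]x, y], so that th increases by at least N * J >= C * J. *)
  have [C HC] := GE x axb Ex.
  have [N CN] : exists N : nat, C <= N%:R.
    exists (Num.bound `|C|); rewrite (le_trans (ler_norm C)) // ltW //.
    exact: archi_boundP.
  have VN : \forall y \near x^'+, forall n : 'I_N, `]x, y] `<=` V n.
    apply: filter_forall => n; have [oV EV _] := HV n.
    have /nbhs_ballP[d /= d0 dV] := open_nbhs_nbhs (conj oV (EV _ Ex)).
    near=> y; move=> s /=; rewrite in_itv /= => /andP[xs sy]; apply: dV.
    rewrite /ball /= ltr0_norm ?subr_lt0 // opprB ltrBlDl (le_lt_trans sy) //.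
    by near: y; apply: nbhs_right_lt; rewrite ltrDl.
  near=> y.
  have xy : x < y by [].
  have yb : y <= b by near: y; exact: nbhs_right_le.
  have VNn : forall n, (n < N)%N -> `]x, y] `<=` V n.
    move=> n nN; suff : forall n : 'I_N, `]x, y] `<=` V n.
      by move=> /(_ (Ordinal nN)).
    by near: y.
  have GJ : G y - G x <= C * (y - x + \int[mu]_(s in `]x, y]) p s) by near: y.
  set J := y - x + \int[mu]_(s in `]x, y]) p s in GJ *.
  have J0 : 0 <= J.
    rewrite -lee_fin -qJ ?(ltW xy) //.
    by apply: integral_ge0 => s _; rewrite lee_fin.
  have IJ n : (n < N)%N -> (I n y = I n x + J%:E)%E.
    move=> nN; rewrite /I /J -qJ ?(ltW xy) // -ge0_integral_setU; first last.
    - apply/disj_setPS => s /= [[_]].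
      rewrite !in_itv /= => /andP[_ sx] /andP[xs _].
      by move: (lt_le_trans xs sx); rewrite ltxx.
    - by move=> s _; rewrite lee_fin.
    - exact: mq.
    - exact: measurable_itv.
    - exact: mI.
    - congr (integral _ _ _); apply/seteqP; split => s /=; rewrite !in_itv /=.
        case=> Vs /andP[as_ sy].
        have [sx|xs] := leP s x; first by left; rewrite as_.
        by right; rewrite sy.
      case=> [[Vs /andP[as_ sx]]|/[dup] xsy /andP[xs sy]].
        by split=> //; rewrite as_ (le_trans sx) // ltW.
      split; first by apply: (VNn n nN); rewrite /= in_itv.
      by rewrite sy (le_lt_trans ax xs).
  have sumN : (\sum_(0 <= n < N) I n y =
      \sum_(0 <= n < N) I n x + (N%:R * J)%:E)%E.
    have -> : (N%:R * J)%:E = (\sum_(0 <= n < N) J%:E)%E.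
      by rewrite sumEFin sumr_const_nat subn0 mulr_natl.
    by rewrite -big_split; apply: eq_big_nat => n /IJ.
  have key : fine (S x) + N%:R * J <= fine (S y).
    rewrite -lee_fin EFinD !fineK // !SE.
    rewrite (nneseries_split 0 N) ?[leRHS](nneseries_split 0 N) //.
    rewrite add0n sumN addeAC.
    apply: leeD2l; apply: lee_nneseries => n *; first exact: I0.
    exact: Ihomo (ltW xy).
  have : C * J <= N%:R * J by rewrite ler_wpM2r.
  have : 0 <= e * (y - x) by rewrite mulr_ge0 ?ltW // subr_gt0.
  rewrite /th; lra.
have : fine (S b) <= e by rewrite -lee_fin fineK.
have : 0 <= fine (S a) by rewrite -lee_fin fineK.
rewrite /th; lra.
Unshelve. all: by end_near. Qed.

(** * Solutions of the Riccati equation and locality of a* *)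

Lemma ae_lebesgue_mono (R : realType) (P Q : R -> Prop) :
  (forall t, P t -> Q t) -> {ae @lebesgue_measure R, forall t, P t} ->
  {ae @lebesgue_measure R, forall t, Q t}.
Proof. by move=> PQ; apply: (@filterS _ _ (ae_filter_ringOfSetsType _)). Qed.

Lemma near_eq_half_line (R : realType) (T : \bar R) (f g : R -> R) (t : R) :
  (forall u, 0 <= u -> (u%:E < T)%E -> f u = g u) ->
  0 < t -> (t%:E < T)%E -> \forall u \near t, f u = g u.
Proof.
move=> fg t0 tT.
have : \forall u \near t, (u%:E < T)%E.
  case: T tT {fg} => [T| |] // tT; last by near=> u; rewrite ltry.
  by rewrite lte_fin in tT; near=> u; rewrite lte_fin; near: u; exact: lt_nbhsl.
apply: filterS2 (lt_nbhsr t0) => u u0 uT; apply: fg => //.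
exact: ltW.
Unshelve. all: by end_near. Qed.

Lemma near_eq_derive1 (R : realType) (f g : R -> R) (t : R) :
  (\forall u \near t, f u = g u) -> derive1 f t = derive1 g t.
Proof. by move=> fg; rewrite !derive1E; exact: near_eq_derive. Qed.

(** Derivatives at 0 involve the values at negative arguments, about which
    nothing is assumed; integrals are therefore compared on intervals that are
    open at 0. *)
Lemma solution_congr (R : realType) (m m' : R -> R) (w r : R) (T : \bar R)
    (phi phi' : R -> R) : (0 < T)%E ->
  (forall u, 0 <= u -> (u%:E < T)%E -> m u = m' u) ->
  (forall u, 0 <= u -> (u%:E < T)%E -> phi u = phi' u) ->
  solution m w r T phi -> solution m' w r T phi'.
Proof.
move=> T0 mm pp [phi0 phiI phiE]; split.
- by rewrite -pp.
- move=> t t0 tT; have [ip pI] := phiI t t0 tT.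
  have dd s : s \in `]0, t] -> derive1 phi s = derive1 phi' s.
    rewrite in_itv /= => /andP[s0 st]; apply: near_eq_derive1.
    apply: near_eq_half_line pp s0 _.
    by rewrite (le_lt_trans _ tT) // lee_fin.
  have ip1 : (@lebesgue_measure R).-integrable `]0, t] (EFin \o derive1 phi).
    apply: integrableS ip => //; apply: subset_itvr; by rewrite bnd_simp.
  have ip2 : (@lebesgue_measure R).-integrable `]0, t] (EFin \o derive1 phi').
    apply: eq_integrable ip1 => // s; rewrite inE => /dd /=.
    by move=> ->.
  have ip3 : (@lebesgue_measure R).-integrable `[0, t] (EFin \o derive1 phi').
    have /integrableP[mp fp] := ip2; apply/integrableP; split.
      exact/emeasurable_fun_itv_obnd_cbndP.
    rewrite -integral_itv_obnd_cbnd //.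
    exact: measurableT_comp mp.
  split; first exact: ip3.
  rewrite -(pp t t0 tT) pI -(Rintegral_itv_obnd_cbnd ip1).
  rewrite -(Rintegral_itv_obnd_cbnd ip2).
  by apply: eq_Rintegral => s; rewrite inE => /dd.
- move: phiE; apply: ae_lebesgue_mono => t H t0 tT.
  have {H}[dm dp E] := H t0 tT.
  have mn := near_eq_half_line mm t0 tT.
  have pn := near_eq_half_line pp t0 tT.
  split; [exact: near_eq_derivable dm|exact: near_eq_derivable dp|].
  rewrite -(near_eq_derive1 pn) E /mu (near_eq_derive1 mn) -pp ?(ltW t0) //.
  by rewrite mm // ltW.
Qed.

Lemma solution_restrict (R : realType) (m : R -> R) (w r : R) (T T' : \bar R)
    (phi : R -> R) : (T' <= T)%E ->
  solution m w r T phi -> solution m w r T' phi.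
Proof.
move=> TT [phi0 phiI phiE]; split => //.
- by move=> t t0 tT; apply: phiI => //; exact: lt_le_trans TT.
- move: phiE; apply: ae_lebesgue_mono => t H t0 tT; apply: H => //.
  exact: lt_le_trans TT.
Qed.

(** Zorn's lemma. A chain of extensions is glued along its union; the union of
    the exceptional null sets is null because countably many members of the
    chain, chosen by means of the rational times, are cofinal. *)
Lemma solution_extends_to_maximal (R : realType) (m : R -> R) (w r : R)
    (T : \bar R) (phi : R -> R) : (0 < T)%E -> solution m w r T phi ->
  exists T' phi', [/\ maximal_solution m w r T' phi', (T <= T')%E &
    forall t, 0 <= t -> (t%:E < T)%E -> phi' t = phi t].
Proof.
move=> T0 sphi.
pose ext (x y : \bar R * (R -> R)) := (x.1 <= y.1)%E /\
  forall t, 0 <= t -> (t%:E < x.1)%E -> y.2 t = x.2 t.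
have ext_refl x : ext x x by split.
have ext_trans x y z : ext x y -> ext y z -> ext x z.
  move=> [xy fxy] [yz fyz]; split; first exact: le_trans yz.
  move=> t t0 tx; rewrite fyz ?fxy //; exact: lt_le_trans xy.
pose sol := {x : \bar R * (R -> R) | ext (T, phi) x /\ solution m w r x.1 x.2}.
have sol0 : sol by exists (T, phi).
have [||A totA|[[T' phi'] [[/= TT' pp'] sp']] maxp] :=
    @ZL_preorder sol sol0 (fun x y => `[< ext (sval x) (sval y) >]).
- by move=> x; apply/asboolP.
- by move=> x y z /asboolP xy /asboolP yz; apply/asboolP; exact: ext_trans yz.
- have [A0|/set0P[x0 Ax0]] := eqVneq A set0.
    by exists sol0 => s; rewrite A0.
  pose T1 := ereal_sup [set (sval x).1 | x in A].
  have phi1P : forall t, exists y, forall x, A x -> 0 <= t ->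
      (t%:E < (sval x).1)%E -> y = (sval x).2 t.
    move=> t; have [[x [Ax t0 tx]]|nx] :=
      pselect (exists x, [/\ A x, 0 <= t & (t%:E < (sval x).1)%E]).
      exists ((sval x).2 t) => y Ay _ ty.
      by have [/asboolP[_ ->]|/asboolP[_ ->]] := totA _ _ Ax Ay.
    by exists 0 => x Ax t0 tx; exfalso; apply: nx; exists x.
  have {phi1P} [phi1 phi1P] := choice phi1P.
  have leT1 x : A x -> ((sval x).1 <= T1)%E.
    by move=> Ax; apply: ereal_sup_ubound; exists x.
  have supT1 t : (t%:E < T1)%E -> exists2 x, A x & (t%:E < (sval x).1)%E.
    by move=> /ereal_sup_gt[_ [x Ax <-] tx]; exists x.
  have solx x : A x -> solution m w r (sval x).1 phi1.
    move=> Ax; case: (svalP x) => -[Tx _]; apply: solution_congr => //.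
      exact: lt_le_trans Tx.
    by move=> t t0 tx; rewrite (phi1P t x).
  have ext1 x : A x -> ext (sval x) (T1, phi1).
    by move=> Ax; split; [exact: leT1|move=> t t0 tx; exact: phi1P].
  have s1 : ext (T, phi) (T1, phi1) /\ solution m w r T1 phi1.
    split.
      by apply: ext_trans (ext1 _ Ax0); case: (svalP x0).
    split.
    - by have [] := solx _ Ax0.
    - by move=> t t0 /supT1[x Ax tx]; have [_ /(_ t t0 tx)] := solx _ Ax.
    - have aeq : \forall t \ae @lebesgue_measure R, forall (n : nat) (q : rat),
          choice.unpickle n = Some q -> ((ratr q : R)%:E < T1)%E ->
          0 < t -> t < ratr q ->
          [/\ derivable m t 1, derivable phi1 t 1 &
            derive1 phi1 t = r * (phi1 t ^+ 2 + 2 * mu m w r t * phi1 t + 1)].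
        apply: ae_foralln => n.
        case: (choice.unpickle n) => [p|]; last exact: aeW.
        have [/supT1[x Ax qx]|] := ltP (ratr p : R)%:E T1; last first.
          by move=> pT; apply: aeW => t q [<-]; rewrite ltNge pT.
        have [_ _] := solx _ Ax; apply: ae_lebesgue_mono => t H q [<-] _ t0 tq.
        by apply: H => //; apply: lt_trans qx; rewrite lte_fin.
      move: aeq; apply: ae_lebesgue_mono => t H t0 tT1.
      have [y ty yT1] : exists2 y, t < y & (y%:E <= T1)%E.
        case: (T1) tT1 => [z| |] // tz; first by exists z.
        by exists (t + 1); rewrite ?ltrDl // leey.
      have [q] := rat_in_itvoo ty; rewrite in_itv /= => /andP[tq qy].
      apply: (H (choice.pickle q) q) => //; first exact: choice.pickleK.
      by apply: lt_le_trans yT1; rewrite lte_fin.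
  exists (exist _ (T1, phi1) s1) => x Ax; apply/asboolP; exact: ext1.
- exists T', phi'; split => //; split => //; first exact: (lt_le_trans T0 TT').
  move=> T2 phi2 T'T2 s2 p2.
  have s2' : ext (T, phi) (T2, phi2).
    by apply: (ext_trans _ (T', phi')); split => //; exact: ltW.
  have := maxp (exist _ (T2, phi2) (conj s2' s2)).
  case/(_ _)/asboolP => /=; first by apply/asboolP; split; [exact: ltW|].
  by rewrite leNgt T'T2.
Qed.

Definition reaches_one (R : realType) (m : R -> R) (w r : R) (t : R) : Prop :=
  0 <= t /\ exists T phi, [/\ solution m w r T phi, (t%:E < T)%E & phi t = 1].

(** Every solution extends to a maximal one, so maximality can be dropped from
    the definition of a*; solutions, unlike maximal ones, can be restricted. *)
Lemma a_star_solutionE (R : realType) (m : R -> R) (w r : R) :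
  a_star m w r = ereal_inf [set t%:E | t in reaches_one m w r].
Proof.
rewrite /a_star; congr (ereal_inf (image _ _)); apply/seteqP; split=> t /=.
  by move=> [t0 [T [phi [[_ sp _] tT pt]]]]; split=> //; exists T, phi.
move=> [t0 [T [phi [sp tT pt]]]]; split=> //.
have T0 : (0 < T)%E by apply: le_lt_trans tT; rewrite lee_fin.
have [T' [phi' [mp TT' pp]]] := solution_extends_to_maximal T0 sp.
by exists T', phi'; split=> //; [exact: lt_le_trans TT'|rewrite pp].
Qed.

Lemma a_star_ge0 (R : realType) (m : R -> R) (w r : R) : (0 <= a_star m w r)%E.
Proof. by apply: le_ereal_inf_tmp => _ [t [t0 _] <-]; rewrite lee_fin. Qed.

(** A solution reaching 1 before L still does so when restricted to times before
    L, where both functions have the same solutions. The minimum with L covers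
    at once the case a* < L and the case a* >= L. *)
Lemma a_star_local (R : realType) (m m' : R -> R) (w r : R) (L : \bar R) :
  (forall t, 0 <= t -> (t%:E < L)%E -> m t = m' t) ->
  mine (a_star m w r) L = mine (a_star m' w r) L.
Proof.
wlog suff : m m' / (forall t, 0 <= t -> (t%:E < L)%E -> m t = m' t) ->
    (mine (a_star m w r) L <= mine (a_star m' w r) L)%E.
  move=> le_min mm; apply/le_anti; rewrite !le_min // => t t0 tL.
  by rewrite mm.
move=> mm; rewrite le_min [X in _ && X]ge_min lexx orbT andbT.
rewrite [leRHS]a_star_solutionE; apply: le_ereal_inf_tmp.
move=> _ [t [t0 [T [phi [sp tT pt]]]] <-].
have [tL|Lt] := ltP t%:E L; last by rewrite ge_min Lt orbT.
rewrite ge_min; apply/orP; left; rewrite a_star_solutionE.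
apply: ereal_inf_lbound; exists t => //; split => //.
have tTL : (t%:E < mine T L)%E by rewrite lt_min tT.
exists (mine T L), phi; split => //.
apply: solution_congr (solution_restrict _ sp); last by rewrite ge_min lexx.
- by apply: le_lt_trans tTL; rewrite lee_fin.
- by move=> u u0; rewrite lt_min => /andP[_ uL]; rewrite mm.
- by [].
Qed.

(** * Submultiplicative minorants *)

Definition nonneg_unital (R : realType) (f : R -> R) : Prop :=
  (forall t, 0 <= t -> 0 <= f t) /\ f 0 = 1.

Definition submultiplicative (R : realType) (f : R -> R) : Prop :=
  forall s t, 0 <= s -> 0 <= t -> f (s + t) <= f s * f t.

Definition subdivision (R : realType) (N : nat) (t : R)
    (tau : 'I_N -> R) : Prop :=
  (forall i, 0 <= tau i) /\ \sum_(i < N) tau i = t.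

Lemma subdivision_le (R : realType) (N : nat) (t : R) (tau : 'I_N -> R) :
  subdivision t tau -> forall i, tau i <= t.
Proof.
move=> [tau0 <-] i; rewrite (bigD1 i) //= lerDl.
by apply: sumr_ge0 => j _.
Qed.

Lemma subdivision_trivial (R : realType) (t : R) :
  0 <= t -> subdivision t (fun _ : 'I_1 => t).
Proof. by move=> t0; split=> //; rewrite big_ord1. Qed.

Definition subdivision_cat (R : realType) (M N : nat) (sigma : 'I_M -> R)
    (tau : 'I_N -> R) (i : 'I_(M + N)) : R :=
  match fintype.split i with inl j => sigma j | inr j => tau j end.

Lemma subdivision_catP (R : realType) (M N : nat) (s t : R) (sigma : 'I_M -> R)
    (tau : 'I_N -> R) : subdivision s sigma -> subdivision t tau ->
  subdivision (s + t) (subdivision_cat sigma tau).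
Proof.
move=> [sigma0 sumsigma] [tau0 sumtau]; split.
  by move=> i; rewrite /subdivision_cat; case: fintype.split.
rewrite big_split_ord /= -sumsigma -sumtau.
by congr (_ + _); apply: eq_bigr => i _; rewrite /subdivision_cat;
  [rewrite (unsplitK (inl i))|rewrite (unsplitK (inr i))].
Qed.

Lemma prod_subdivision_cat (R : realType) (M N : nat) (f : R -> R)
    (sigma : 'I_M -> R) (tau : 'I_N -> R) :
  \prod_i f (subdivision_cat sigma tau i) =
  (\prod_i f (sigma i)) * \prod_i f (tau i).
Proof.
rewrite big_split_ord /=.
by congr (_ * _); apply: eq_bigr => i _; rewrite /subdivision_cat;
  [rewrite (unsplitK (inl i))|rewrite (unsplitK (inr i))].
Qed.

(** A subdivision can be refined by adding null intervals, whose factor is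
    m(0) = 1, so the infima over N intervals decrease and their limit is the
    infimum over all subdivisions. N.+1 avoids the empty subdivision, which
    only exists for t = 0. *)
Lemma frakS_glb (R : realType) (f : R -> R) (t : R) :
  nonneg_unital f -> 0 <= t ->
  (forall N (tau : 'I_N.+1 -> R), subdivision t tau ->
     frakS f t <= \prod_i f (tau i)) /\
  (forall c, (forall N (tau : 'I_N.+1 -> R), subdivision t tau ->
     c <= \prod_i f (tau i)) -> c <= frakS f t).
Proof.
move=> [f0 f1] t0.
pose prods N := [set \prod_(i < N) f (tau i) | tau in
  [set tau : 'I_N -> R | subdivision t tau]].
have prods_ge0 N : lbound (prods N) 0.
  by move=> _ [tau [tau0 _] <-]; apply: prodr_ge0 => i _; exact: f0.
have prodsS N : prods N `<=` prods N.+1.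
  move=> _ [tau htau <-]; rewrite -addn1.
  exists (subdivision_cat tau (fun _ : 'I_1 => 0)).
    by rewrite /= -[t]addr0; exact/(subdivision_catP htau)/subdivision_trivial.
  by rewrite prod_subdivision_cat big_ord1 f1 mulr1.
have prods_neq0 N : prods N.+1 !=set0.
  elim: N => [|N [x px]]; last by exists x; exact: prodsS.
  exists (\prod_(i < 1) f t), (fun _ => t) => //.
  exact: subdivision_trivial.
have has_inf_prods N : has_inf (prods N.+1) by split; last by exists 0.
have ninc : nonincreasing_seq (fun N => inf (prods N.+1)).
  apply/nonincreasing_seqP => N; apply: lb_le_inf => // x /prodsS.
  by apply: ge_inf; exists 0.
have cvgp : cvgn (fun N => inf (prods N.+1)).
  apply: nonincreasing_is_cvgn => //; exists 0 => _ [N _ <-].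
  exact: lb_le_inf.
have limE : frakS f t = limn (fun N => inf (prods N.+1)).
  apply/cvg_lim => //; rewrite -cvg_shiftS.
  exact: cvgp.
split.
  move=> N tau htau; rewrite limE.
  apply: le_trans (nonincreasing_cvgn_ge ninc cvgp N) _.
  by apply: ge_inf; [exists 0|exists tau].
move=> c hc; rewrite limE; apply: limr_ge => //; apply: nearW => N.
by apply: lb_le_inf => // _ [tau htau <-]; exact: hc.
Qed.

Lemma frakS_ge0 (R : realType) (f : R -> R) (t : R) :
  nonneg_unital f -> 0 <= t -> 0 <= frakS f t.
Proof.
move=> nf t0; apply: (frakS_glb nf t0).2 => N tau [tau0 _].
by apply: prodr_ge0 => i _; exact: nf.1.
Qed.

Lemma frakS_le (R : realType) (f : R -> R) (t : R) :
  nonneg_unital f -> 0 <= t -> frakS f t <= f t.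
Proof.
move=> nf t0; have := (frakS_glb nf t0).1 _ _ (subdivision_trivial t0).
by rewrite big_ord1.
Qed.

Lemma submultiplicative_sum (R : realType) (g : R -> R) (N : nat)
    (tau : 'I_N -> R) : nonneg_unital g -> submultiplicative g ->
  (forall i, 0 <= tau i) -> g (\sum_i tau i) <= \prod_i g (tau i).
Proof.
move=> [g0 g1] sg; elim: N tau => [|N IH] tau tau0.
  by rewrite !big_ord0 g1.
rewrite !big_ord_recl; apply: le_trans (sg _ _ _ _) _ => //.
  by apply: sumr_ge0.
by rewrite ler_wpM2l ?g0 // IH.
Qed.

(** A submultiplicative function is at most the product of its values along any
    subdivision, and the lengths in a subdivision of t are at most t. *)
Lemma le_frakS (R : realType) (f g : R -> R) (t : R) :
  nonneg_unital f -> nonneg_unital g -> submultiplicative g -> 0 <= t ->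
  (forall s, 0 <= s <= t -> g s <= f s) -> g t <= frakS f t.
Proof.
move=> nf ng sg t0 gf; apply: (frakS_glb nf t0).2 => N tau ht.
case: (ht) => tau0 <-; apply: le_trans (submultiplicative_sum ng sg tau0) _.
apply: ler_prod => i _; rewrite ng.1 //= gf // tau0 /=.
exact: subdivision_le ht i.
Qed.

Lemma frakS_nonneg_unital (R : realType) (f : R -> R) :
  nonneg_unital f -> nonneg_unital (frakS f).
Proof.
move=> nf; split; first by move=> t; exact: frakS_ge0.
apply/le_anti; rewrite -{1}nf.2 frakS_le //=.
apply: (@le_frakS _ f (cst 1)) => //.
- by move=> s u _ _; rewrite /= mulr1.
- by move=> s /le_anti <-; rewrite nf.2.
Qed.

(** Concatenating subdivisions of s and of t gives one of s + t. The infima are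
    passed to one at a time, with separate arguments for vanishing factors,
    by which one cannot divide. *)
Lemma frakS_submultiplicative (R : realType) (f : R -> R) :
  nonneg_unital f -> submultiplicative (frakS f).
Proof.
move=> nf s t s0 t0.
have st0 : 0 <= s + t by exact: addr_ge0.
have prod0 N (tau : 'I_N -> R) u : subdivision u tau -> 0 <= \prod_i f (tau i).
  by move=> [tau0 _]; apply: prodr_ge0 => i _; exact: nf.1.
have A0 := frakS_ge0 nf s0.
have le1 N (tau : 'I_N.+1 -> R) : subdivision t tau ->
    frakS f (s + t) <= frakS f s * \prod_i f (tau i).
  move=> ht; have Q0 := prod0 _ _ _ ht.
  have le2 M (sigma : 'I_M.+1 -> R) : subdivision s sigma ->
      frakS f (s + t) <= (\prod_i f (sigma i)) * \prod_i f (tau i).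
    move=> hs; rewrite -prod_subdivision_cat; apply: (frakS_glb nf st0).1.
    exact: (subdivision_catP hs ht).
  move: Q0; rewrite le_eqVlt => /predU1P[Q0|Q0].
    rewrite -Q0 mulr0; have := le2 _ _ (subdivision_trivial s0).
    by rewrite -Q0 mulr0.
  rewrite -ler_pdivrMr //; apply: (frakS_glb nf s0).2 => M sigma hs.
  by rewrite ler_pdivrMr //; exact: le2.
move: A0; rewrite le_eqVlt => /predU1P[A0|A0].
  have := le1 _ _ (subdivision_trivial t0).
  by rewrite -A0 !mul0r.
rewrite mulrC -ler_pdivrMr //; apply: (frakS_glb nf t0).2 => N tau ht.
by rewrite ler_pdivrMr // mulrC; exact: le1.
Qed.

Lemma frakS_local (R : realType) (f g : R -> R) (t : R) :
  (forall s, 0 <= s <= t -> f s = g s) -> frakS f t = frakS g t.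
Proof.
move=> fg; rewrite /frakS; apply: (f_equal (fun u : nat -> R => limn u)).
apply/funext => N; congr inf; apply/seteqP.
split => _ [tau ht <-]; exists tau => //; apply: eq_bigr => i _;
  rewrite fg // (proj1 ht) /=; exact: (@subdivision_le R N t tau ht i).
Qed.

(** * Positivity of a* *)

Lemma derive_right_slope_lt (R : realType) (f : R -> R) (x l C : R) :
  is_derive x 1 f l -> l < C -> \forall y \near x^'+, f y - f x <= C * (y - x).
Proof.
move=> [df dl] lC.
have : (fun h => h^-1 *: (f (h *: 1 + x) - f x)) @ 0^' --> l.
  by rewrite -dl; exact: df.
move=> /cvgr_lt /(_ C lC) [e /= e0 He].
near=> y.
have xy : 0 < y - x by rewrite subr_gt0.
have ye : y - x < e.
  by rewrite ltrBlDl; near: y; apply: nbhs_right_lt; rewrite ltrDl.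
have H : (y - x)^-1 * (f y - f x) < C.
  have := He (y - x); rewrite /= /GRing.scale /= sub0r normrN gtr0_norm //.
  rewrite mulr1 subrK.
  by move=> /(_ ye (lt0r_neq0 xy)).
by rewrite ltW // -ltr_pdivrMr // mulrC.
Unshelve. all: by end_near. Qed.

Lemma last_crossing (R : realType) (f : R -> R) (a b y : R) : a <= b ->
  {within `[a, b], continuous f} -> f a <= y <= f b ->
  exists c, [/\ a <= c <= b, f c = y & forall x, c <= x <= b -> y <= f x].
Proof.
move=> ab cf /andP[fa fb].
pose A := [set x | a <= x <= b /\ f x <= y].
have Aa : A a by rewrite /A /= lexx ab.
have supA : has_sup A by split; [exists a|exists b => x [/andP[]]].
have ubA x : A x -> x <= sup A by apply: ub_le_sup; exact: supA.2.
have ac : a <= sup A by exact: ubA.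
have cb : sup A <= b by apply: ge_sup; [exists a|move=> x [/andP[]]].
set c := sup A in ubA ac cb.
have fc : f c <= y.
  rewrite leNgt; apply/negP => yfc.
  have abc : `[a, b]%classic c by rewrite /= in_itv /= ac.
  have e0 : 0 < f c - y by rewrite subr_gt0.
  have /subspace_continuousP /(_ c abc) /cvgrPdist_lt /(_ _ e0) := cf.
  rewrite near_withinE => -[d /= d0 dP].
  have [x Ax cdx] := sup_adherent d0 supA; rewrite -/c in cdx.
  have xc : x <= c by exact: ubA.
  have [/andP[ax xb] fxy] := Ax.
  have := dP x; rewrite /ball_ /= ger0_norm ?subr_ge0 // in_itv /= ax xb.
  have cxd : c - x < d by lra.
  move=> /(_ cxd isT) /(le_lt_trans (ler_norm _)).
  by rewrite /from_subspace => ?; lra.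
have cfcb : {within `[c, b], continuous f}.
  apply: continuous_subspaceW cf; apply: subset_itvr; by rewrite bnd_simp.
have ivt x : c <= x <= b -> y <= f x -> exists2 z, z \in `[c, x] & f z = y.
  move=> /andP[cx xb] yfx; apply: IVT => //.
    apply: continuous_subspaceW cfcb; apply: subset_itvl; by rewrite bnd_simp.
  by rewrite ge_min fc le_max yfx orbT.
have max z : c <= z <= b -> f z <= y -> z = c.
  move=> /andP[cz zb] fzy; apply/le_anti; rewrite cz andbT; apply: ubA.
  by split=> //; rewrite zb (le_trans ac).
have cE : f c = y.
  have [|z] := ivt b _ fb; first by rewrite cb lexx.
  rewrite in_itv /= => zcb fz; rewrite -fz; congr f; apply/esym/max => //.
  by rewrite fz.
exists c; split; rewrite ?ac //.
move=> x cxb; rewrite leNgt; apply/negP => fxy.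
have : x = c by apply: max => //; exact: ltW.
by move=> xc; rewrite xc cE ltxx in fxy.
Qed.

(** The last crossing of - y by the function t |-> - f (- t), reflected. *)
Lemma first_crossing (R : realType) (f : R -> R) (a b y : R) : a <= b ->
  {within `[a, b], continuous f} -> f a <= y <= f b ->
  exists c, [/\ a <= c <= b, f c = y & forall x, a <= x <= c -> f x <= y].
Proof.
move=> ab cf fab.
have [|||c [cab fc H]] :=
  @last_crossing R (fun x => - f (- x)) (- b) (- a) (- y).
- by rewrite lerN2.
- apply/subspace_continuousP => x xab; apply/cvgrPdist_lt => e e0.
  have nab : `[a, b]%classic (- x).
    by move: xab; rewrite /= !in_itv /= lerNl lerNr andbC.
  have /subspace_continuousP /(_ _ nab) /cvgrPdist_lt /(_ _ e0) := cf.
  rewrite !near_withinE => -[d /= d0 dP]; exists d => // z /= xz zab.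
  rewrite /from_subspace (_ : _ - _ = - (f (- x) - f (- z))); last by ring.
  rewrite normrN; apply: dP.
    by rewrite /ball_ /= (_ : _ - _ = - (x - z)) ?normrN //; ring.
  by move: zab; rewrite /= !in_itv /= lerNl lerNr andbC.
- by rewrite !opprK !lerN2 andbC.
exists (- c); split.
- by rewrite lerNl lerNr andbC.
- by rewrite -[LHS]opprK fc opprK.
- move=> x axc; rewrite -lerN2 -[x]opprK; apply: H.
  by rewrite lerN2 lerNr andbC.
Qed.

Lemma solution_continuous (R : realType) (m : R -> R) (w r : R) (T : \bar R)
    (phi : R -> R) (b : R) : 0 <= b -> (b%:E < T)%E ->
  solution m w r T phi -> {within `[0, b], continuous phi}.
Proof.
move=> b0 bT [_ phiI _].
have [ip _] := phiI b b0 bT.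
have := parameterized_integral_continuous b0 ip.
apply: subspace_eq_continuous => x; rewrite inE /= in_itv /= => /andP[x0 xb].
rewrite /from_subspace /parameterized_integral.
by have [|_ <-] := phiI x x0; first by rewrite (le_lt_trans _ bT) // lee_fin.
Qed.

Lemma solution_increment_le (R : realType) (m : R -> R) (w r : R) (T : \bar R)
    (phi : R -> R) (x y : R) : 0 <= x -> x <= y -> (y%:E < T)%E ->
  solution m w r T phi ->
  phi y - phi x <= \int[@lebesgue_measure R]_(s in `]x, y]) `|derive1 phi s|.
Proof.
move=> x0 xy yT [_ phiI _]; have y0 := le_trans x0 xy.
have [ip ->] := phiI y y0 yT.
have [|_ ->] := phiI x x0; first by rewrite (le_lt_trans _ yT) // lee_fin.
rewrite Rintegral_itvB // ?bnd_simp //.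
apply: le_trans (ler_norm _) _; apply: le_normr_Rintegral => //.
apply: integrableS ip => //; apply: subset_itvr; by rewrite bnd_simp.
Qed.

(** ln phi - 2 ln m - K x is nonincreasing. Off the exceptional null set this is
    the equation divided by phi. On it, ln phi is controlled by the integral of
    |phi'|, because ln is 2-Lipschitz above 1/2, and ln m by its derivative. *)
Lemma ln_solution_increment (R : realType) (m : R -> R) (w r : R) (T : \bar R)
    (phi : R -> R) (c d : R) : 0 < r -> 0 < c -> c <= d -> (d%:E < T)%E ->
  solution m w r T phi ->
  (forall t, 0 <= t -> 0 < m t) -> {within `[0, +oo[, continuous m} ->
  (forall x, c <= x < d -> derivable (fun t => ln (m t)) x 1) ->
  (forall x, c <= x <= d -> 2^-1 <= phi x <= 1) ->
  ln (phi d) - ln (phi c) <=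
    2 * (ln (m d) - ln (m c)) + (3 * r + 2 * `|w|) * (d - c).
Proof.
move=> r0 c0 cd dT sphi m0 cm dlnm phi12.
(* On [1/2, 1], phi + 1/phi is at most 1 + 2. *)
set K := 3 * r + 2 * `|w|.
have K0 : 0 <= K by rewrite addr_ge0 // mulr_ge0 // ltW.
pose G x := ln (phi x) - 2 * ln (m x) - K * x.
suff : G d <= G c by rewrite /G; lra.
have phi0 x : c <= x <= d -> 0 < phi x.
  by move=> /phi12/andP[+ _]; apply: lt_le_trans; rewrite invr_gt0.
have ip : (@lebesgue_measure R).-integrable `[0, d] (EFin \o derive1 phi).
  by have [_ /(_ d (le_trans (ltW c0) cd) dT)[]] := sphi.
have cd0d : `[c, d] `<=` `[0, d].
  by apply: subset_itvr; rewrite bnd_simp ltW.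
have [_ _ phiE] := sphi.
apply: (@nonincreasing_off_negligible R c d G (fun s => `|derive1 phi s|)
  _ cd _ phiE).
- apply/subspace_continuousP => x xcd.
  have cxd : c <= x <= d by move: xcd; rewrite /= in_itv.
  have clnphi : ln (phi y) @[y --> within `[c, d] (nbhs x)] --> ln (phi x).
    apply: continuous_cvg; first by apply: continuous_ln; exact: phi0.
    have : {within `[c, d], continuous phi}.
      apply: continuous_subspaceW cd0d _.
      by apply: solution_continuous dT sphi; rewrite (le_trans (ltW c0)).
    by move=> /subspace_continuousP /(_ _ xcd).
  have clnm : ln (m y) @[y --> within `[c, d] (nbhs x)] --> ln (m x).
    apply: continuous_cvg.
      by apply: continuous_ln; apply: m0; lra.
    have : {within `[c, d], continuous m}.
      apply: continuous_subspaceW cm; apply: subset_itv;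
        by rewrite ?bnd_simp // ltW.
    by move=> /subspace_continuousP /(_ _ xcd).
  apply: cvgB; first by apply: cvgB clnphi _; apply: cvgMl_tmp.
  apply: cvgMl_tmp; apply: cvg_within.
- by apply: integrable_norm; apply: integrableS ip.
- by move=> x _; exact: normr_ge0.
- move=> x /andP[cx xd] /contrapT => H e e0.
  have [||dm dphi E] := H; first exact: lt_le_trans cx.
    by rewrite (lt_trans _ dT) // lte_fin.
  have cxd : c <= x <= d by rewrite cx ltW.
  have px := phi0 x cxd; have mx := m0 x (le_trans (ltW c0) cx).
  have dG : is_derive x 1 G
      ((phi x)^-1 * derive1 phi x - 2 * ((m x)^-1 * derive1 m x) - K).
    have d1 : is_derive x 1 (@ln R \o phi) ((phi x)^-1 * derive1 phi x).
      apply: is_derive1_comp; first exact: is_derive1_ln.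
      by rewrite derive1E; exact: derivableP.
    have d2 : is_derive x 1 (@ln R \o m) ((m x)^-1 * derive1 m x).
      apply: is_derive1_comp; first exact: is_derive1_ln.
      by rewrite derive1E; exact: derivableP.
    have -> : G = (@ln R \o phi) - (2 *: (@ln R \o m)) - (K *: id).
      by apply/funext => t; rewrite /G /GRing.scale.
    apply: is_deriveB; rewrite -[X in is_derive _ _ _ X]mulr1.
    exact: is_deriveZ.
  apply: derive_right_slope_lt dG _; apply: le_lt_trans e0.
  have -> : (phi x)^-1 * derive1 phi x - 2 * ((m x)^-1 * derive1 m x) - K =
      r * (phi x + (phi x)^-1) - 2 * w - K.
    by rewrite E /mu; field; rewrite !lt0r_neq0.
  have /andP[p1 p2] := phi12 x cxd.
  have pV : (phi x)^-1 <= 2.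
    by rewrite -[leRHS]invrK lef_pV2 ?posrE // invr_gt0.
  have : r * (phi x + (phi x)^-1) <= r * 3 by rewrite ler_pM2l //; lra.
  have := ler_norm (- w); rewrite normrN /K; lra.
- move=> x /[dup] cxd' /andP[cx xd] _.
  have cxd : c <= x <= d by rewrite cx ltW.
  have px := phi0 x cxd.
  have dl : is_derive x 1 (fun t => - ln (m t))
      (- derive1 (fun t => ln (m t)) x).
    by apply: is_deriveN; rewrite derive1E; apply: derivableP; exact: dlnm.
  set l := derive1 _ x in dl.
  (* The slope of - 2 ln m, and the Lipschitz constant 2 of ln. *)
  exists (2 * (`|l| + 1) + 2); near=> y.
  have xy : x < y by [].
  have yd : y <= d by near: y; exact: nbhs_right_le.
  have cyd : c <= y <= d by rewrite yd (le_trans cx) // ltW.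
  have py := phi0 y cyd.
  have l1 : - ln (m y) - - ln (m x) <= (`|l| + 1) * (y - x).
    near: y; apply: derive_right_slope_lt dl _.
    by have := ler_norm (- l); rewrite normrN; lra.
  have inc : phi y - phi x <=
      \int[@lebesgue_measure R]_(s in `]x, y]) `|derive1 phi s|.
    apply: solution_increment_le sphi; rewrite ?(ltW xy) //.
      exact: le_trans (ltW c0) cx.
    by rewrite (le_lt_trans _ dT) // lee_fin.
  set J := Rintegral _ _ _ in inc *.
  have J0 : 0 <= J by apply: Rintegral_ge0 => s _; exact: normr_ge0.
  have l2 : ln (phi y) - ln (phi x) <= 2 * J.
    rewrite -ln_div ?posrE //.
    have -> : phi y / phi x = 1 + (phi y - phi x) / phi x.
      by field; rewrite lt0r_neq0.
    apply: le_trans (le_ln1Dx _) _.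
      by rewrite mulrBl mulfV ?lt0r_neq0 // ltrBrDr addNr divr_gt0.
    rewrite ler_pdivrMr //; apply: le_trans inc _.
    have /andP[p1 _] := phi12 x cxd.
    have : 0 <= J * (phi x - 2^-1) by rewrite mulr_ge0 // subr_ge0.
    by lra.
  have : 0 <= K * (y - x) by rewrite mulr_ge0 // subr_ge0 ltW.
  have : 0 <= (2 * (`|l| + 1)) * J by rewrite mulr_ge0 // mulr_ge0 // addr_ge0.
  by rewrite /G; lra.
Unshelve. all: by end_near. Qed.

(** A solution reaching 1 at a small time climbs from 1/2 to 1 on a short
    interval, on which ln m, continuous at 0, hardly varies;
    ln_solution_increment then bounds ln 2 by a small number. *)
Lemma a_star_gt0 (R : realType) (m : R -> R) (w r : R) : 0 < r ->
  (forall t, 0 <= t -> 0 < m t) -> {within `[0, +oo[, continuous m} ->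
  piecewise_differentiable (fun t => ln (m t)) -> m 0 = 1 ->
  (0 < a_star m w r)%E.
Proof.
move=> r0 m0 cm [e [e0 eS _ he]] m1.
have e1 : 0 < e 1%N by rewrite -e0; exact: eS.
have dlnm x : 0 < x < e 1%N -> derivable (fun t => ln (m t)) x 1.
  by move=> x0e; have [+ _ _] := he 0%N; apply; rewrite e0.
pose K := 3 * r + 2 * `|w|.
have K0 : 0 < K by rewrite ltr_wpDr // mulr_gt0.
have ln2 : 0 < ln 2 :> R by rewrite ln_gt0 // ltr1n.
have [d d0 dP] : exists2 d, 0 < d & forall x, 0 <= x -> x < d ->
    `|ln (m x)| < ln 2 / 8.
  have oo0 : `[0, +oo[%classic (0 : R) by rewrite /= in_itv /= lexx.
  have : ln (m y) @[y --> within `[0, +oo[ (nbhs (0 : R))] --> ln (m 0).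
    apply: continuous_cvg; first by apply: continuous_ln; rewrite m1.
    by move/subspace_continuousP : cm => /(_ _ oo0).
  have ln28 : 0 < ln 2 / 8 :> R by rewrite divr_gt0.
  rewrite m1 ln1 => /cvgrPdist_lt /(_ _ ln28).
  rewrite near_withinE => -[d /= d0 dP]; exists d => // x x0 xd.
  have := dP x; rewrite /ball_ /= !sub0r !normrN ger0_norm // in_itv /= x0.
  by move=> /(_ xd isT).
(* Before D, twice a difference of values of ln m is below ln 2 / 2, and so is
   K times a duration. *)
pose D := Num.min d (Num.min (e 1%N) (ln 2 / (2 * K))).
have D0 : 0 < D by rewrite !lt_min d0 e1 divr_gt0 // mulr_gt0.
suff : (D%:E <= a_star m w r)%E by apply: lt_le_trans; rewrite lte_fin.
rewrite a_star_solutionE; apply: le_ereal_inf_tmp.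
move=> _ [t1 [t10 [T [phi [sphi tT pt]]]] <-].
rewrite lee_fin leNgt; apply/negP; rewrite !lt_min => /and3P[t1d t1e t1K].
have cphi := solution_continuous t10 tT sphi.
have phi0 : phi 0 = 0 by case: sphi.
have half01 : 0 < 2^-1 :> R /\ 2^-1 < 1 :> R by split; lra.
have [|t2 [/andP[t20 t21] pt2 le1]] := first_crossing (y := 1) t10 cphi.
  by rewrite phi0 pt lexx ler01.
have cphi2 : {within `[0, t2], continuous phi}.
  by apply: continuous_subspaceW cphi; apply: subset_itvl; rewrite bnd_simp.
have [|t3 [/andP[t30 t32] pt3 geh]] := last_crossing (y := 2^-1) t20 cphi2.
  by rewrite phi0 pt2 !ltW //; case: half01.
have t3_gt0 : 0 < t3.
  rewrite lt_neqAle t30 andbT; apply/eqP => t3E.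
  by move: pt3; rewrite -t3E phi0; lra.
have t2T : (t2%:E < T)%E by rewrite (le_lt_trans _ tT) // lee_fin.
have := ln_solution_increment r0 t3_gt0 t32 t2T sphi m0 cm.
rewrite pt2 pt3 ln1 lnV ?posrE // sub0r opprK => H.
have {H} : ln 2 <= 2 * (ln (m t2) - ln (m t3)) + K * (t2 - t3).
  apply: H => x /andP[x3 x2].
    apply: dlnm; rewrite (lt_le_trans t3_gt0 x3) (lt_trans x2) //.
    exact: le_lt_trans t1e.
  by rewrite geh ?x3 //= le1 // (le_trans t30) ?x3.
have := dP t2 t20 (le_lt_trans t21 t1d); rewrite ltr_norml => /andP[_ h2].
have := dP t3 t30 (le_lt_trans t32 (le_lt_trans t21 t1d)).
rewrite ltr_norml => /andP[h3 _].
have : K * (t2 - t3) <= K * t1 by rewrite ler_pM2l //; lra.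
have : K * t1 < ln 2 / 2.
  by move: t1K; rewrite ltr_pdivlMr ?mulr_gt0 // => ?; lra.
lra.
Qed.

(** * The operators U and their infimum *)

Lemma U_le (R : realType) (n : R -> R) (w r t : R) : U n w r t <= n t.
Proof.
by rewrite /U; case: a_star => // a; case: ifP => // _; rewrite ge_min lexx.
Qed.

Lemma U_ge0 (R : realType) (n : R -> R) (w r t : R) :
  0 <= n t -> 0 <= U n w r t.
Proof.
move=> nt; rewrite /U; case: a_star => // a; case: ifP => // _.
by rewrite le_min nt mulr_ge0 ?expR_ge0 ?sqr_ge0.
Qed.

Lemma U_before (R : realType) (n : R -> R) (w r t : R) :
  ((t / 2)%:E <= a_star n w r)%E -> U n w r t = n t.
Proof.
rewrite /U; case: a_star => // a; rewrite lee_fin => ta.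
by rewrite ifT //; lra.
Qed.

(** The bound imposed by U_w depends on n only through a* and the value of n
    there, so that a function below U_w(n) with the same two values already
    satisfies it. *)
Lemma U_fixed (R : realType) (n n' : R -> R) (w r : R) :
  (forall t, 0 <= t -> n' t <= U n w r t) ->
  a_star n' w r = a_star n w r ->
  (forall b, a_star n w r = b%:E -> n' b = n b) ->
  forall t, 0 <= t -> U n' w r t = n' t.
Proof.
move=> n'U aE nb t t0; have := n'U t t0; rewrite /U aE.
case E : a_star => [b| |] //; case: ifP => // _.
by rewrite le_min (nb b E) => /andP[_ h]; apply/min_idPl.
Qed.

Lemma U_inf_lower_bound (R : realType) (Omega : {fset R}) (r n : R -> R)
    (w t : R) :
  w \in Omega -> 0 <= n t -> U_inf Omega r n t <= U n w (r w) t.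
Proof.
move=> wO nt; apply: ge_inf; last by exists w.
by exists 0 => _ [v _ <-]; exact: U_ge0.
Qed.

Lemma le_U_inf (R : realType) (Omega : {fset R}) (r n : R -> R) (c t : R) :
  Omega != fset0 -> (forall w, w \in Omega -> c <= U n w (r w) t) ->
  c <= U_inf Omega r n t.
Proof.
move=> /fset0Pn[w wO] h; apply: lb_le_inf; first by exists (U n w (r w) t), w.
by move=> _ [v vO <-]; exact: h.
Qed.

Lemma U_inf_id (R : realType) (Omega : {fset R}) (r n : R -> R) (t : R) :
  Omega != fset0 -> 0 <= n t ->
  (forall w, w \in Omega -> U n w (r w) t = n t) -> U_inf Omega r n t = n t.
Proof.
move=> O0 nt UE; apply/le_anti/andP; split; last first.
  by apply: le_U_inf => // w /UE ->.
have /fset0Pn[w wO] := O0.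
by rewrite (le_trans (U_inf_lower_bound r wO nt)) // UE.
Qed.

Lemma U_inf_nonneg_unital (R : realType) (Omega : {fset R}) (r n : R -> R) :
  Omega != fset0 -> nonneg_unital n -> nonneg_unital (U_inf Omega r n).
Proof.
move=> O0 [n0 n1]; split.
  by move=> t t0; apply: le_U_inf => // w _; apply: U_ge0; exact: n0.
rewrite U_inf_id ?n1 // => w _.
by rewrite U_before ?n1 // mul0r a_star_ge0.
Qed.

Lemma SU_congr (R : realType) (Omega : {fset R}) (r n n' : R -> R) :
  (forall t, 0 <= t -> n t = n' t) ->
  forall t, 0 <= t -> SU Omega r n t = SU Omega r n' t.
Proof.
move=> nn t t0; apply: frakS_local => s /andP[s0 _]; rewrite /U_inf.
congr inf; apply/eq_imagel => w _.
have aE : a_star n w (r w) = a_star n' w (r w).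
  have := @a_star_local R n n' w (r w) +oo%E.
  by rewrite !miney; apply => u u0 _; exact: nn.
rewrite /U aE; case E : a_star => [a| |]; rewrite ?nn //.
by have := a_star_ge0 n' w (r w); rewrite E lee_fin.
Qed.

(** * Stationarity *)

(** This is where a > 0 matters: agreement up to 2a is then agreement beyond a,
    and a_star_local applies with L = 2a. The condition t / 2 <= a stands for
    t <= 2a, so that a may be infinite. *)
Lemma a_star_horizon (R : realType) (n n' : R -> R) (a : \bar R) : (0 < a)%E ->
  (forall t, 0 <= t -> ((t / 2)%:E <= a)%E -> n t = n' t) -> forall w r,
  ((a_star n w r <= a)%E -> a_star n' w r = a_star n w r) /\
  ((a <= a_star n w r)%E -> (a <= a_star n' w r)%E).
Proof.
case: a => [a| |] // a0 nn w r; last first.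
  have := @a_star_local R n n' w r +oo%E.
  by rewrite !miney => -> // t t0 _; apply: nn => //; rewrite leey.
rewrite lte_fin in a0.
have a2 : (a%:E < (2 * a)%:E)%E by rewrite lte_fin; lra.
have loc : mine (a_star n w r) (2 * a)%:E = mine (a_star n' w r) (2 * a)%:E.
  apply: a_star_local => t t0; rewrite lte_fin => ta; apply: nn => //.
  by rewrite lee_fin; lra.
split=> ha.
- have h : (a_star n w r < (2 * a)%:E)%E by exact: le_lt_trans a2.
  move: loc; rewrite (min_idPl (ltW h)) => loc.
  apply/esym; rewrite loc; apply/min_idPl; rewrite leNgt; apply/negP => h'.
  by move: h; rewrite loc (min_idPr (ltW h')) ltxx.
- have : (a%:E <= mine (a_star n' w r) (2 * a)%:E)%E.
    by rewrite -loc le_min ha ltW.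
  by rewrite le_min => /andP[].
Qed.

Lemma fset_argmin (R : realType) (T : choiceType) (f : T -> \bar R)
    (A : {fset T}) : A != fset0 ->
  exists2 y, y \in A & forall z, z \in A -> (f y <= f z)%E.
Proof.
have argmin (s : seq T) x : exists2 y, y \in x :: s &
    forall z, z \in x :: s -> (f y <= f z)%E.
  elim: s x => [|x' s IH] x.
    by exists x; rewrite ?mem_head // => z; rewrite inE => /eqP ->.
  have [y ys fy] := IH x'; have [xy|yx] := leP (f x) (f y).
    exists x; first exact: mem_head.
    by move=> z; rewrite inE => /predU1P[->//|/fy]; exact: le_trans.
  exists y; first by rewrite inE ys orbT.
  by move=> z; rewrite inE => /predU1P[->|/fy //]; exact: ltW.
move=> /fset0Pn[x xA].
suff : forall s : seq T, x \in s ->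
    exists2 y, y \in s & forall z, z \in s -> (f y <= f z)%E.
  by move=> /(_ (enum_fset A) xA).
by case=> // x' s _; exact: argmin.
Qed.

(** The invariant of the iteration: D is the set of points already used up. The
    last condition says that they come first in the order of increasing a*,
    which guarantees that later steps do not disturb them. *)
Definition settled (R : realType) (Omega : {fset R}) (r n : R -> R)
    (D : {fset R}) : Prop :=
  [/\ nonneg_unital n, submultiplicative n,
      forall w, w \in Omega -> (0 < a_star n w (r w))%E,
      (D `<=` Omega)%fset /\
        (forall w, w \in D -> forall t, 0 <= t -> U n w (r w) t = n t) &
      forall w w', w \in D -> w' \in Omega -> w' \notin D ->
        (a_star n w (r w) <= a_star n w' (r w'))%E].

(** The point gained is one where a* is minimal among the remaining points: up
    to twice this minimum the function does not change, so that the points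
    already used up stay so, and the new one becomes so by U_fixed. *)
Lemma settled_step (R : realType) (Omega : {fset R}) (r n : R -> R)
    (D : {fset R}) : settled Omega r n D -> D != Omega ->
  exists w, [/\ w \in Omega, w \notin D &
    settled Omega r (SU Omega r n) (w |` D)%fset].
Proof.
move=> [nn sn a_gt0 [DO DU] aD] DneO.
have [w0 w0O w0D] : exists2 w0, w0 \in Omega & w0 \notin D.
  have : ~~ (Omega `<=` D)%fset.
    by apply: contra DneO => OD; rewrite eqEfsubset DO.
  by move=> /fsubsetPn[w0]; exists w0.
have Omega0 : Omega != fset0 by apply/fset0Pn; exists w0.
have [w1 w1OD w1min] : exists2 w1, w1 \in (Omega `\` D)%fset &
    forall w, w \in (Omega `\` D)%fset ->
      (a_star n w1 (r w1) <= a_star n w (r w))%E.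
  apply: (fset_argmin (fun w => a_star n w (r w))).
  by apply/fset0Pn; exists w0; rewrite inE w0D.
move: (w1OD); rewrite inE => /andP[w1D w1O].
exists w1; split => //.
set a := a_star n w1 (r w1) in w1min.
have a0 : (0 < a)%E by exact: a_gt0.
set n' := SU Omega r n.
have nU := U_inf_nonneg_unital r Omega0 nn.
have agree t : 0 <= t -> ((t / 2)%:E <= a)%E -> n t = n' t.
  move=> t0 ta.
  have Uid s : 0 <= s <= t -> U_inf Omega r n s = n s.
    move=> /andP[s0 st]; apply: U_inf_id => //; first exact: nn.1.
    move=> w wO; have [wD|wD] := boolP (w \in D); first exact: DU.
    apply: U_before; apply: (@le_trans _ _ a); last first.
      by apply: w1min; rewrite inE wD.
    by apply: le_trans ta; rewrite lee_fin ler_pM2r.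
  apply/le_anti/andP; split; first by apply: le_frakS => // s st; rewrite Uid.
  by rewrite -[leRHS]Uid ?t0 ?lexx //; exact: frakS_le.
have le_n' t : 0 <= t -> n' t <= U_inf Omega r n t by exact: frakS_le.
have hor := a_star_horizon a0 agree.
have a_le w : w \in (w1 |` D)%fset -> (a_star n w (r w) <= a)%E.
  by rewrite !inE => /predU1P[->//|wD]; exact: aD.
have le_a w : w \in Omega -> w \notin (w1 |` D)%fset ->
    (a <= a_star n' w (r w))%E.
  rewrite !inE negb_or => wO /andP[_ wD]; apply: (hor w (r w)).2.
  by apply: w1min; rewrite inE wD.
have aE w : w \in (w1 |` D)%fset -> a_star n' w (r w) = a_star n w (r w).
  by move=> wD; apply: (hor w (r w)).1; exact: a_le.
split.
- exact: frakS_nonneg_unital.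
- exact: frakS_submultiplicative.
- move=> w wO; have [wD|wD] := boolP (w \in (w1 |` D)%fset).
    by rewrite aE // a_gt0.
  exact: lt_le_trans (le_a w wO wD).
- split; first by rewrite fsubUset fsub1set w1O.
  move=> w wD; apply: (@U_fixed _ n) => //; last 2 first.
  + exact: aE.
  + move=> b ab; have b0 : 0 <= b.
      by have := a_star_ge0 n w (r w); rewrite ab lee_fin.
    apply/esym/agree => //; apply: le_trans (a_le w wD).
    by rewrite ab lee_fin; lra.
  + move=> t t0; have wO : w \in Omega.
      by move: wD; rewrite !inE => /predU1P[->//|]; exact: (fsubsetP DO).
    exact: le_trans (le_n' t t0) (U_inf_lower_bound r wO (nn.1 t t0)).
- by move=> w w' wD w'O w'D; rewrite aE // (le_trans (a_le w wD)) // le_a.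
Qed.

Lemma settled_fixed (R : realType) (Omega : {fset R}) (r n : R -> R) :
  Omega != fset0 -> settled Omega r n Omega ->
  forall t, 0 <= t -> SU Omega r n t = n t.
Proof.
move=> O0 [nn sn _ [_ DU] _] t t0.
have nU := U_inf_nonneg_unital r O0 nn.
have Uid s : 0 <= s -> U_inf Omega r n s = n s.
  by move=> s0; apply: U_inf_id => //; [exact: nn.1|move=> w /DU; apply].
apply/le_anti/andP; split.
  by rewrite -[leRHS]Uid //; exact: frakS_le.
by apply: le_frakS => // s /andP[s0 _]; rewrite Uid.
Qed.

Theorem proposition4p5 (R : realType) (H : completeNormedModType R[i])
  (dot : {dot H for Num.conj}) (hH : induces_norm dot)
  (S : R -> {linear H -> H}) (hS : strongly_continuous_semigroup S)
  (m : R -> R)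
  (m_gt0 : forall t, 0 <= t -> 0 < m t)
  (m_cont : {within `[0, +oo[, continuous m})
  (m_diff : piecewise_differentiable (fun t => ln (m t)))
  (m0 : m 0 = 1)
  (S_le_m : forall t, 0 <= t -> (opnorm (S t) <= (m t)%:E)%E)
  (m_inv : forall t, 0 <= t -> frakS m t = m t)
  (Omega : {fset R}) (Omega_neq0 : Omega != fset0)
  (r_gt0 : forall w, w \in Omega -> 0 < resolvent_r (generator S) w) :
  forall k : nat, (#|` Omega| <= k)%N ->
  forall t, 0 <= t ->
    iter k (SU Omega (resolvent_r (generator S))) m t =
    iter #|` Omega| (SU Omega (resolvent_r (generator S))) m t.
Proof.
set r := resolvent_r (generator S).
pose M k := iter k (SU Omega r) m.
have m_unital : nonneg_unital m by split=> // t /m_gt0/ltW.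
have settled0 : settled Omega r m fset0.
  split=> //.
  - move=> s t s0 t0; rewrite -!m_inv ?addr_ge0 //.
    exact: frakS_submultiplicative.
  - by move=> w wO; apply: a_star_gt0 => //; exact: r_gt0.
have settledM k : (k <= #|` Omega|)%N ->
    exists2 D : {fset R}, #|` D| = k & settled Omega r (M k) D.
  elim: k => [_|k IH kO]; first by exists fset0; rewrite ?cardfs0.
  have [D Dk sD] := IH (ltnW kO).
  have DneO : D != Omega.
    by apply/eqP => DO; move: kO; rewrite -Dk DO ltnn.
  have [w [_ wD sw]] := settled_step sD DneO.
  by exists (w |` D)%fset => //; rewrite cardfsU1 wD Dk.
have [D DO sD] := settledM _ (leqnn _).
have {}DO : D = Omega.
  by apply/eqP; rewrite eqEfcard DO leqnn andbT; case: sD => _ _ _ [].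
rewrite {}DO in sD.
move=> k /subnK <-; rewrite addnC; elim: (k - _)%N => [|j IH] t t0.
  by rewrite addn0.
rewrite addnS iterS -/(M _).
by rewrite (SU_congr Omega r IH t0); exact: settled_fixed.
Qed.
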